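(* Let $H$ be a separable real Hilbert space, $1/3<\eta<1/2$, and let $\mathcal P$ be a nonempty family of continuous $H$-valued semimartingale laws on $\Omega_H$ for which the common accessibility hypothesis holds, with accessible realization $\mathcal A_2:\Omega_H\to\mathsf Z_\eta$. Let $\mathcal O:\mathsf Z_\eta\to\mathsf R^{\rm coh}$ and $\mathcal D=\mathcal O^{-1}$ be the encoder and decoder of the principal quadratic response specification $\mathfrak Q_2(H)$. Then every $\mathcal P$-causal source state $(\mathsf S,S)$ satisfies $$S\text{ jointly realizes }\mathfrak Q_2(H)\iff\mathcal A_2\preceq S.$$ If $\Psi_S$ is a joint realization, the factor is the stable-causal map $\mathcal D\Psi_S:\mathsf S\to\mathsf Z_\eta$. Conversely, a stable-causal map $R:\mathsf S\to\mathsf Z_\eta$ satisfying $R(S)=\mathcal A_2$ quasi surely produces the joint realization $\mathcal OR$. These assignments are inverse to each other after maps agreeing on the realized source under every law are identified. Hence $\mathcal A_2$ is the unique least jointly sufficient state up to stable-causal equivalence.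
   Context: $0<T<\infty$. $\mathcal L,\mathcal S_1,\mathcal S_2$: bounded, trace-class, Hilbert--Schmidt operators on $H$; subscripts sk, sa: skew-adjoint, self-adjoint. $x\otimes y$ is $h\mapsto\langle y,h\rangle x$, $x^{\otimes2}=x\otimes x$, $\operatorname{Anti}U=\frac12(U-U^* )$. $\Delta_T=\{0\le s\le t\le T\}$, $x_{s,t}=x_t-x_s$. State space. $\mathbb G=H\times\mathcal S_2(H)_{\rm sk}\times\mathcal S_1(H)_{\rm sa}$ with product $(x,a,q)\star(y,b,r)=(x+y,a+b+\operatorname{Anti}(x\otimes y),q+r)$. $G\Omega^2_\eta(H;\mathcal S_2)$ is the closure, in the $\eta$/$2\eta$-H\''older metric on levels in $H\times\mathcal S_2$, of step-two signatures $(x_{s,t},\int_s^tx_{s,r}\otimes dx_r)$ of smooth paths from $0$ in finite-dimensional subspaces. $C_0^{0,\alpha}$ is the little-H\''older space (closure of smooth paths from $0$ in $\alpha$-H\''older norm). $\mathsf Z_\eta$ is the set of continuous $g:[0,T]\to\mathbb G$ starting at the identity whose increments $g_s^{-1}\star g_t=(x_{s,t},A_{s,t},q_{s,t})$ satisfy $(x,\frac12x^{\otimes2}+A)\in G\Omega^2_\eta(H;\mathcal S_2)$ and $q\in C_0^{0,2\eta}([0,T];\mathcal S_1(H)_{\rm sa})$; $\operatorname{ch}(g)=(x,A,q)$; metric $|x-\tilde x|_{\eta;H}+|A-\tilde A|_{2\eta;\mathcal S_2}+|q-\tilde q|_{2\eta;\mathcal S_1}$; truncation $(\rho_tg)_u=g_{u\wedge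 t}$. Response target. $\mathbb K_A=\{K\in\mathcal S_2(H)_{\rm sk}:\|K\|_2\le1\}$ (weak topology), $\mathbb K_Q=\{S\in\mathcal L(H)_{\rm sa}:\|S\|_{\rm op}\le1\}$ (topology $\sigma(\mathcal L,\mathcal S_1)$); $\jmath_A(a)(K)=\operatorname{Tr}(K^*a)$, $\jmath_Q(q)(S)=\operatorname{Tr}(Sq)$. $\mathsf R^{\rm coh}$ is the closure, in $C_0^{0,\eta}([0,T];H)\times\mathscr H^{0,2\eta}_{\Delta_T}(C(\mathbb K_A))\times\mathscr H^{0,2\eta}_{\Delta_T}(C(\mathbb K_Q))$ ($\mathscr H^{0,\alpha}_{\Delta_T}(E)$: little-H\''older closure of continuous two-index $E$-valued fields vanishing on the diagonal), of the profiles $(x,(\jmath_AA^x_{s,t}),(\jmath_Q(q_t-q_s)))$ with $x$ piecewise $C^1$ from $0$ in a finite-dimensional subspace, $A^x_{s,t}=\operatorname{Anti}\int_s^tx_{s,r}\otimes dx_r$, and $q$ piecewise $C^1$ from $0$ with finite-rank self-adjoint values; truncation is stopping. $\mathcal O(x,A,q)=(x,(\jmath_AA_{s,t}),(\jmath_Qq_{s,t}))$ is a stable-causal isometric homeomorphism of $\mathsf Z_\eta$ onto $\mathsf R^{\rm coh}$ with inverse $\mathcal D$. Causality. A causal Polish space is a Polish space with continuous truncations $\rho_t$ ($\rho_T=I$, $\rho_s\rho_t=\rho_{s\wedge t}$); $R$ is stable-causal if continuous with $\rho_tR=\rho_tR\rho_t$. $\Omega_H=C_0([0,T];H)$, coordinate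 process $X$, $(r_tx)_u=x_{u\wedge t}$. Quasi surely: $P$-a.s. for every $P\in\mathcal P$. A $\mathcal P$-causal state is a Borel $S:\Omega_H\to\mathsf S$ into a causal Polish space such that on a Borel set of full measure for all $P\in\mathcal P$, $r_t\omega=r_t\omega'$ implies $\rho_tS(\omega)=\rho_tS(\omega')$ for all $t$. $T\preceq S$ iff $T=R(S)$ quasi surely for some stable-causal $R$; stable-causal equivalence is mutual $\preceq$. Under $P$, $M^P$ is the continuous local martingale part of $X$, $\langle\!\langle M^P\rangle\!\rangle$ its operator bracket, $A^P_{s,t}=\operatorname{Anti}\int_s^tX_{s,r}\otimes dX_r$. A joint realization of $\mathfrak Q_2(H)$ by $S$ is a single stable-causal $\Psi_S:\mathsf S\to\mathsf R^{\rm coh}$ with $\Psi_S(S)=(X,\jmath_AA^P,\jmath_Q\langle\!\langle M^P\rangle\!\rangle)$ $P$-a.s. for all $P\in\mathcal P$; states admitting one are jointly sufficient, and a jointly sufficient state is least if it is $\preceq$ every jointly sufficient state. Common accessibility: there is a single Borel $\mathcal P$-causal state $\mathcal A_2:\Omega_H\to\mathsf Z_\eta$ with $\operatorname{ch}(\mathcal A_2)=(X,A^P,\langle\!\langle M^P\rangle\!\rangle)$ $P$-a.s. for every $P\in\mathcal P$. *)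

(* Defs.v *)
From HB Require Import structures.
From mathcomp Require Import all_boot all_order all_algebra.
From mathcomp Require Import all_classical all_reals all_analysis.

Set Implicit Arguments.
Unset Strict Implicit.
Unset Printing Implicit Defensive.

Import Order.TTheory GRing.Theory Num.Theory.
Import numFieldNormedType.Exports.

Local Open Scope classical_set_scope.
Local Open Scope ring_scope.

HB.mixin Record isHilbert (R : realType) H & CompleteNormedModule R H := {
  dot : H -> H -> R;
  dotC : forall x y, dot x y = dot y x;
  dotDl : forall x y z, dot (x + y) z = dot x z + dot y z;
  dotZl : forall (c : R) x y, dot (c *: x) y = c * dot x y;
  dot_norm : forall x, dot x x = `|x| ^+ 2
}.

#[short(type="hilbertType")]
HB.structure Definition Hilbert (R : realType) :=
  { H of CompleteNormedModule R H & isHilbert R H }.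

Definition separable (X : topologicalType) :=
  exists2 D : set X, countable D & dense D.

Section operators.
Context {R : realType} {H : hilbertType R}.
Implicit Types (a b p q : H -> H) (x y : H).

Definition bounded_op a := linear a /\ continuous a.

Definition self_adjoint a := forall x y, dot (a x) y = dot x (a y).

Definition skew_adjoint a := forall x y, dot (a x) y = - dot x (a y).

Definition positive_op a := forall x, 0 <= dot x (a x).

Definition finite_rank a :=
  exists n (v : 'I_n -> H), forall x, exists c : 'I_n -> R,
    a x = \sum_(i < n) c i *: v i.

Definition op_norm a : \bar R :=
  ereal_sup [set `|a x|%:E | x in [set x : H | `|x| <= 1]].

Definition adjoint a : H -> H :=
  get [set b : H -> H | bounded_op b /\ forall x y, dot (a x) y = dot x (b y)].

(* Zero vectors are allowed, so that a finite-dimensional space has such a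
   sequence as well: the nonzero terms form an orthonormal basis. *)
Definition hilbert_basis (e : nat -> H) :=
  [/\ forall i, e i = 0 \/ `|e i| = 1,
      forall i j, i <> j -> dot (e i) (e j) = 0 &
      forall x, (forall i, dot (e i) x = 0) -> x = 0].

Definition onb : nat -> H := get [set e : nat -> H | hilbert_basis e].

Definition trace a : R :=
  limn (fun n => \sum_(i < n) dot (onb i) (a (onb i))).

Definition hs_norm a : \bar R :=
  sqrte (\sum_(i <oo) (`|a (onb i)| ^+ 2)%R%:E)%E.

(* |a|, the positive square root of a^* a *)
Definition abs_op a : H -> H :=
  get [set p : H -> H | [/\ bounded_op p, self_adjoint p, positive_op p &
                            p \o p = adjoint a \o a]].

Definition tr_norm a : \bar R :=
  (\sum_(i <oo) (dot (onb i) (abs_op a (onb i)))%:E)%E.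

Definition hs_op : set (H -> H) :=
  [set a | bounded_op a /\ (hs_norm a < +oo)%E].

Definition tc_op : set (H -> H) :=
  [set a | bounded_op a /\ (tr_norm a < +oo)%E].

Definition hs_skew : set (H -> H) := [set a | hs_op a /\ skew_adjoint a].

Definition tc_sa : set (H -> H) := [set a | tc_op a /\ self_adjoint a].

Definition tensor x y : H -> H := fun h => dot y h *: x.

Definition anti a : H -> H := 2^-1 *: (a - adjoint a).

End operators.

Definition vnorm {R : realType} {V : normedModType R} (x : V) : \bar R :=
  `|x|%:E.

Definition sup_norm {R : realType} {K : Type} (f : K -> R) : \bar R :=
  ereal_sup [set `|f k|%:E | k in [set: K]].

Definition time (R : realType) (T : R) : Type := `[0, T]%classic.
HB.instance Definition _ R T :=
  Topological.copy (@time R T) (set_type `[0, T]%classic).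

Section time.
Context {R : realType} {T : R}.
Local Notation I := (time T).

Definition tval (t : I) : R := set_val t.

Definition tmin (s t : I) : I := if tval s <= tval t then s else t.

Definition simplex_set : set (I * I) := [set p | tval p.1 <= tval p.2].
Definition simplex : Type := simplex_set.
HB.instance Definition _ := Topological.copy simplex (set_type simplex_set).

Definition lo (p : simplex) : I := (set_val p).1.
Definition hi (p : simplex) : I := (set_val p).2.
Definition len (p : simplex) : R := tval (hi p) - tval (lo p).

Lemma smin_subproof (p : simplex) (t : I) :
  (tmin (lo p) t, tmin (hi p) t) \in simplex_set.
Proof.
have pp : tval (lo p) <= tval (hi p) by exact: (set_valP p).
apply/mem_set; rewrite /simplex_set /= /tmin.
case: ifPn => lot; case: ifPn => hit //.
by rewrite (le_trans pp hit) in lot.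
Qed.

Definition smin (p : simplex) (t : I) : simplex :=
  @exist _ (fun x => x \in simplex_set) _ (smin_subproof p t).

Definition stop {V : Type} (t : I) (x : I -> V) : I -> V :=
  fun u => x (tmin u t).

Definition stop2 {V : Type} (t : I) (F : simplex -> V) : simplex -> V :=
  fun p => F (smin p t).

Definition from0 {V : nmodType} (x : I -> V) := forall u, tval u = 0 -> x u = 0.

Definition incr {V : zmodType} (x : I -> V) : simplex -> V :=
  fun p => x (hi p) - x (lo p).

Definition subdivision (s t : I) (n : nat) (pi : nat -> I) :=
  [/\ pi 0%N = s, pi n = t &
      forall i, (i < n)%N -> tval (pi i) <= tval (pi i.+1)].

Definition mesh_le (n : nat) (pi : nat -> I) (delta : R) :=
  forall i, (i < n)%N -> tval (pi i.+1) - tval (pi i) <= delta.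

(* In this section [E], a linear subspace of [V] with the extended-valued norm
   [N], plays the role of a normed space. *)
Section normed.
Context {V : lmodType R} (E : set V) (N : V -> \bar R).

Definition path_continuous (x : I -> V) := forall t (e : R), 0 < e ->
  \forall u \near t, (N (x u - x t)%R < e%:E)%E.

Definition field_continuous (F : simplex -> V) := forall p (e : R), 0 < e ->
  \forall q \near p, (N (F q - F p)%R < e%:E)%E.

Definition hoelder (alpha : R) (F : simplex -> V) : \bar R :=
  ereal_sup [set (N (F p) * (len p `^ (- alpha))%R%:E)%E
            | p in [set p | 0 < len p]].

Definition is_deriv_on (J : set I) (x x' : I -> V) :=
  forall t, J t -> forall e : R, 0 < e ->
  \forall u \near t, J u ->
    (N (x u - x t - (tval u - tval t) *: x' t)%R <=
       (e * `|tval u - tval t|)%R%:E)%E.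

Definition smooth (x : I -> V) := exists D : nat -> I -> V,
  [/\ D 0%N = x, forall n t, E (D n t) &
      forall n, is_deriv_on setT (D n) (D n.+1)].

Definition C1_on (J : set I) (x : I -> V) := exists D : I -> V,
  [/\ forall t, J t -> E (D t), is_deriv_on J x D &
      forall t, J t -> forall e : R, 0 < e ->
        \forall u \near t, J u -> (N (D u - D t)%R < e%:E)%E].

Definition piecewise_C1 (x : I -> V) := (forall t, E (x t)) /\
  exists s t n pi, [/\ tval s = 0, tval t = T, subdivision s t n pi &
    forall i, (i < n)%N ->
      C1_on [set u | tval (pi i) <= tval u <= tval (pi i.+1)] x].

Definition little_hoelder (alpha : R) : set (I -> V) :=
  [set x | [/\ forall t, E (x t), from0 x & forall e : R, 0 < e ->
     exists2 y, smooth y /\ from0 y & (hoelder alpha (incr (x - y)%R) < e%:E)%E]].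

(* "Little" for a field vanishing on the diagonal: |F_{s,t}| = o(|t-s|^alpha)
   uniformly, i.e. the alpha-Hoelder limits of fields vanishing near the
   diagonal. *)
Definition little_hoelder2 (alpha : R) : set (simplex -> V) :=
  [set F | [/\ forall p, E (F p), field_continuous F,
     forall p, len p = 0 -> F p = 0 &
     forall e : R, 0 < e -> exists2 delta : R, 0 < delta &
       forall p, 0 < len p < delta ->
         (N (F p) <= (e * len p `^ alpha)%R%:E)%E]].

End normed.

Definition in_finite_dim {V : lmodType R} (x : I -> V) :=
  exists n (v : 'I_n -> V), forall t, exists c : 'I_n -> R,
    x t = \sum_(i < n) c i *: v i.

End time.
Arguments simplex {R} T.

Definition dist_space {R : realType} {S : Type} (d : S -> S -> \bar R) : Type := S.

Section dist_space.
Context {R : realType} {S : Type} (d : S -> S -> \bar R).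

Definition dist_open : set (set S) :=
  [set A | forall x, A x -> exists2 e : R, 0 < e &
     [set y | (d x y < e%:E)%E] `<=` A].

Lemma dist_openT : dist_open setT.
Proof. by move=> x _; exists 1. Qed.

Lemma dist_openI : setI_closed dist_open.
Proof.
move=> A B oA oB x [Ax Bx].
have [e e0 eA] := oA _ Ax; have [f f0 fB] := oB _ Bx.
exists (Num.min e f); first by rewrite lt_min e0 f0.
move=> y /= dxy; split.
  by apply: eA => /=; rewrite (lt_le_trans dxy)// lee_fin ge_min lexx.
by apply: fB => /=; rewrite (lt_le_trans dxy)// lee_fin ge_min lexx orbT.
Qed.

Lemma dist_open_bigU (I : Type) (f : I -> set S) :
  (forall i, dist_open (f i)) -> dist_open (\bigcup_i f i).
Proof.
move=> of_ x [i _ fix_]; have [e e0 ef] := of_ i _ fix_.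
by exists e => // y /ef fy; exists i.
Qed.

HB.instance Definition _ := gen_eqMixin (dist_space d).
HB.instance Definition _ := gen_choiceMixin (dist_space d).
HB.instance Definition _ := isOpenTopological.Build (dist_space d)
  dist_openT dist_openI dist_open_bigU.

End dist_space.

Definition polish (R : realType) (S : topologicalType) := exists d : S -> S -> R,
  [/\ [/\ forall x y, d x y = 0 <-> x = y,
          forall x y, d x y = d y x &
          forall x y z, d x z <= d x y + d y z],
      forall A : set S, open A <->
        (forall x, A x -> exists2 e : R, 0 < e & [set y | d x y < e] `<=` A),
      forall u : nat -> S,
        (forall e : R, 0 < e -> exists n0, forall m n,
           (n0 <= m)%N -> (n0 <= n)%N -> d (u m) (u n) < e) ->
        exists l : S, u @ \oo --> l &
      separable S].

Record causal_space (R : realType) (T : R) := CausalSpace {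
  cs_sort :> topologicalType;
  trunc : time T -> cs_sort -> cs_sort }.

Section causality.
Context {R : realType} {T : R}.

Definition causal_polish (S : causal_space T) :=
  [/\ polish R S,
      forall t, continuous (@trunc _ _ S t),
      forall t x, tval t = T -> @trunc _ _ S t x = x &
      forall s t x,
        @trunc _ _ S s (trunc t x) = @trunc _ _ S (tmin s t) x].

Definition stable_causal (S S' : causal_space T) (f : S -> S') :=
  continuous f /\ forall t x, trunc t (f x) = trunc t (f (trunc t x)).

End causality.

Section rough.
Context {R : realType} (H : hilbertType R) (T : R) (eta : R).
Local Notation I := (time T).
Local Notation op := (H -> H).
Local Notation simplex := (simplex T).

(* The integrals of x_{s,r} (x) dx_r, along smooth paths as well as along
   semimartingales below, are limits of these left-point sums. *)
Definition riemann_sum (x : I -> H) (s : I) (n : nat) (pi : nat -> I) : op :=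
  \sum_(i < n) tensor (x (pi i) - x s) (x (pi i.+1) - x (pi i)).

Definition path_integral (x : I -> H) (p : simplex) : op :=
  get [set J : op | hs_op J /\ forall e : R, 0 < e ->
    exists2 delta : R, 0 < delta & forall n pi,
      subdivision (lo p) (hi p) n pi -> mesh_le n pi delta ->
      (hs_norm (riemann_sum x (lo p) n pi - J)%R <= e%:E)%E].

Definition path_area (x : I -> H) (p : simplex) : op := anti (path_integral x p).

Definition geometric : set ((simplex -> H) * (simplex -> op)) :=
  [set XX | (forall p, hs_op (XX.2 p)) /\ forall e : R, 0 < e ->
    exists2 y : I -> H,
      [/\ smooth setT vnorm y, from0 y & in_finite_dim y] &
      (hoelder vnorm eta (XX.1 - incr y)%R +
       hoelder hs_norm (2 * eta)%R (XX.2 - path_integral y)%R < e%:E)%E].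

(* The group G is the subset [group_carrier] of [group_type]. *)
Definition group_type : Type := (H * op * op)%type.

Definition group_carrier : set group_type :=
  [set g | hs_skew g.1.2 /\ tc_sa g.2].

Definition group_mul (g h : group_type) : group_type :=
  (g.1.1 + h.1.1, g.1.2 + h.1.2 + anti (tensor g.1.1 h.1.1), g.2 + h.2).

Definition group_id : group_type := (0, 0, 0).

Definition group_inv (g : group_type) : group_type := (- g.1.1, - g.1.2, - g.2).

Definition group_path : Type := I -> group_type.

Definition group_incr (g : group_path) (p : simplex) : group_type :=
  group_mul (group_inv (g (lo p))) (g (hi p)).

(* Continuity is for the product of the norm topologies of H, S_2 and S_1. *)
Definition zeta_set : set group_path :=
  [set g | [/\ forall t, group_carrier (g t),
     [/\ path_continuous vnorm (fun t => (g t).1.1),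
         path_continuous hs_norm (fun t => (g t).1.2) &
         path_continuous tr_norm (fun t => (g t).2)],
     forall t, tval t = 0 -> g t = group_id,
     geometric
       (fun p => (group_incr g p).1.1,
        fun p => 2^-1 *: tensor (group_incr g p).1.1 (group_incr g p).1.1
                 + (group_incr g p).1.2) &
     little_hoelder tc_sa tr_norm (2 * eta) (fun t => (g t).2)]].

(* (x, A, q): levels one and three are paths, level two is a two-index field. *)
Definition lift_type : Type := ((I -> H) * (simplex -> op) * (I -> op))%type.

Definition ch (g : group_path) : lift_type :=
  (fun t => (g t).1.1, fun p => (group_incr g p).1.2, fun t => (g t).2).

Definition zeta_dist (g g' : group_path) : \bar R :=
  (hoelder vnorm eta (incr ((ch g).1.1 - (ch g').1.1)%R) +
   hoelder hs_norm (2 * eta)%R ((ch g).1.2 - (ch g').1.2)%R +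
   hoelder tr_norm (2 * eta)%R (incr ((ch g).2 - (ch g').2)%R))%E.

Definition zeta_topology : topologicalType :=
  dist_space (fun g g' : set_type zeta_set =>
    zeta_dist (set_val g) (set_val g')).

(* Stopping preserves [zeta_set]: the default value of [insubd] plays no role. *)
Definition zeta_trunc (t : I) (g : set_type zeta_set) : set_type zeta_set :=
  insubd g (stop t (set_val g)).

Definition Zeta : causal_space T := @CausalSpace R T zeta_topology zeta_trunc.

Definition zeta_val (g : Zeta) : group_path :=
  set_val (g : set_type zeta_set).

Definition KA_set : set op := [set K | hs_skew K /\ (hs_norm K <= 1%:E)%E].
Definition KA : Type := set_type KA_set.

Definition KQ_set : set op :=
  [set S | [/\ bounded_op S, self_adjoint S & (op_norm S <= 1%:E)%E]].
Definition KQ : Type := set_type KQ_set.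

HB.instance Definition _ := Choice.copy KA (set_type KA_set).
HB.instance Definition _ := Choice.copy KQ (set_type KQ_set).

Definition KA_pairing (K : KA) : {ptws set_type (@hs_op R H) -> R} :=
  fun a => trace (adjoint (set_val K) \o set_val a).
HB.instance Definition _ := Topological.copy KA (initial_topology KA_pairing).

Definition KQ_pairing (S : KQ) : {ptws set_type (@tc_op R H) -> R} :=
  fun q => trace (set_val S \o set_val q).
HB.instance Definition _ := Topological.copy KQ (initial_topology KQ_pairing).

Definition jA (a : op) : KA -> R := fun K => trace (adjoint (set_val K) \o a).
Definition jQ (q : op) : KQ -> R := fun S => trace (set_val S \o q).

Definition response_type : Type :=
  ((I -> H) * (simplex -> KA -> R) * (simplex -> KQ -> R))%type.

Definition encode (c : lift_type) : response_type :=
  (c.1.1, fun p => jA (c.1.2 p), fun p => jQ (incr c.2 p)).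

Definition response_space : set response_type :=
  [set r | [/\ little_hoelder setT vnorm eta r.1.1,
     little_hoelder2 [set f : KA -> R | continuous f] sup_norm (2 * eta) r.1.2 &
     little_hoelder2 [set f : KQ -> R | continuous f] sup_norm (2 * eta) r.2]].

Definition profiles : set response_type :=
  [set r | exists (x : I -> H) (q : I -> op),
    [/\ [/\ piecewise_C1 setT vnorm x, from0 x & in_finite_dim x],
        [/\ piecewise_C1 tc_sa tr_norm q, from0 q &
            forall t, finite_rank (q t)] &
        r = encode (x, path_area x, q)]].

Definition response_dist (r r' : response_type) : \bar R :=
  (hoelder vnorm eta (incr (r.1.1 - r'.1.1)%R) +
   hoelder sup_norm (2 * eta)%R (r.1.2 - r'.1.2)%R +
   hoelder sup_norm (2 * eta)%R (r.2 - r'.2)%R)%E.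

Definition coh_set : set response_type :=
  [set r | response_space r /\ forall e : R, 0 < e ->
    exists2 r', profiles r' & (response_dist r r' < e%:E)%E].

Definition coh_topology : topologicalType :=
  dist_space (fun r r' : set_type coh_set =>
    response_dist (set_val r) (set_val r')).

Definition response_stop (t : I) (r : response_type) : response_type :=
  (stop t r.1.1, stop2 t r.1.2, stop2 t r.2).

(* As for [zeta_trunc], stopping preserves [coh_set]. *)
Definition coh_trunc (t : I) (r : set_type coh_set) : set_type coh_set :=
  insubd r (response_stop t (set_val r)).

Definition Rcoh : causal_space T := @CausalSpace R T coh_topology coh_trunc.

Definition coh_val (r : Rcoh) : response_type :=
  set_val (r : set_type coh_set).

(* O(x, A, q) = (x, j_A A, j_Q q), a stable-causal isometric homeomorphism of
   Z_eta onto R^coh with inverse D. *)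
Definition encoder_decoder (O : Zeta -> Rcoh) (D : Rcoh -> Zeta) :=
  [/\ forall g, coh_val (O g) = encode (ch (zeta_val g)),
      forall g g', response_dist (coh_val (O g)) (coh_val (O g')) =
                   zeta_dist (zeta_val g) (zeta_val g'),
      cancel O D /\ cancel D O,
      stable_causal O &
      stable_causal D].

End rough.

Section path_space.
Context {R : realType} (H : hilbertType R) (T : R).

Definition C0_set : set {uniform time T -> H} :=
  [set x | continuous (x : time T -> H) /\ from0 (x : time T -> H)].

Definition Omega : Type := set_type C0_set.
HB.instance Definition _ := Topological.copy Omega (set_type C0_set).

Lemma C0_set0 : ((fun=> 0) : {uniform time T -> H}) \in C0_set.
Proof.
apply/mem_set; split; last by [].
exact: cst_continuous.
Qed.

HB.instance Definition _ := isPointed.Build Omega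
  (@exist _ (fun x => x \in C0_set) _ C0_set0).

Definition coord (w : Omega) : time T -> H := set_val w.

Definition OmegaB := g_sigma_algebraType (@open Omega).

Definition law := probability OmegaB R.

End path_space.

Section semimartingales.
Context {R : realType} {H : hilbertType R} {T : R}.
Local Notation I := (time T).
Local Notation op := (H -> H).
Local Notation Om := (OmegaB H T).
Local Notation simplex := (simplex T).
Implicit Type P : law H T.

Definition natural_filtration (t : I) : set (set Om) :=
  <<s [set A | exists r (U : set H), [/\ tval r <= tval t, open U &
                 A = (fun w => coord w r) @^-1` U]] >>.

(* For t = T the second condition is void and all Borel sets are included. *)
Definition right_filtration (t : I) : set (set Om) :=
  [set A | measurable A /\
    forall u, tval t < tval u -> natural_filtration u A].

Definition filtration P (t : I) : set (set Om) :=
  [set A | exists2 B, right_filtration t B &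
             P.-negligible ((A `\` B) `|` (B `\` A))].

Definition adapted P {V : topologicalType} (Y : Om -> I -> V) :=
  forall t (U : set V), open U -> filtration P t [set w | U (Y w t)].

(* [Y t] is only measurable for the P-completion, hence the Borel version [Z]. *)
Definition martingale P (Y : Om -> I -> R) := adapted P Y /\
  exists Z : I -> Om -> R,
  [/\ forall t, P.-integrable setT (EFin \o Z t),
      forall t, {ae P, forall w, Z t w = Y w t} &
      forall s t A, tval s <= tval t -> right_filtration s A ->
        (\int[P]_(w in A) (Z s w)%:E = \int[P]_(w in A) (Z t w)%:E)%E].

Definition hmartingale P (Y : Om -> I -> H) :=
  [/\ adapted P Y,
      forall t, exists2 Z : Om -> R, P.-integrable setT (EFin \o Z) &
        {ae P, forall w, Z w = `|Y w t|} &
      forall h, martingale P (fun w t => dot h (Y w t))].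

Definition stopping_time P (tau : Om -> I) :=
  forall t, filtration P t [set w | tval (tau w) <= tval t].

(* The horizon [0, T] is compact: localizing sequences eventually equal T. *)
Definition localizing P (tau : nat -> Om -> I) :=
  [/\ forall n, stopping_time P (tau n),
      {ae P, forall w, forall n, tval (tau n w) <= tval (tau n.+1 w)} &
      {ae P, forall w, exists n0, forall n, (n0 <= n)%N -> tval (tau n w) = T}].

Definition stopped {V : Type} (Y : Om -> I -> V) (tau : Om -> I) :=
  fun w => stop (tau w) (Y w).

Definition continuous_null0 P {V : normedModType R} (Y : Om -> I -> V) :=
  {ae P, forall w, continuous (Y w) /\ from0 (Y w)}.

Definition local_martingale P (Y : Om -> I -> R) :=
  [/\ adapted P Y, continuous_null0 P (Y : Om -> I -> R^o) &
      exists2 tau, localizing P tau &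
        forall n, martingale P (stopped Y (tau n))].

Definition hlocal_martingale P (Y : Om -> I -> H) :=
  [/\ adapted P Y, continuous_null0 P Y &
      exists2 tau, localizing P tau &
        forall n, hmartingale P (stopped Y (tau n))].

Definition finite_variation (v : I -> H) := exists C : R, forall s t n pi,
  subdivision s t n pi -> \sum_(i < n) `|v (pi i.+1) - v (pi i)| <= C.

Definition is_martingale_part P (M : Om -> I -> H) :=
  hlocal_martingale P M /\
  {ae P, forall w, finite_variation (coord w - M w)}.

Definition semimartingale_law P := exists M, is_martingale_part P M.

(* The processes M^P, <<M^P>> and A^P are unique up to indistinguishability; a
   version is selected by [get], and they are only used up to P-null sets. *)
Definition martingale_part P : Om -> I -> H :=
  get [set M : Om -> I -> H | is_martingale_part P M].

Definition is_operator_bracket P (M : Om -> I -> H) (Q : Om -> I -> op) :=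
  {ae P, forall w,
    [/\ forall t, tc_sa (Q w t), from0 (Q w), path_continuous tr_norm (Q w) &
        forall p : simplex, positive_op (incr (Q w) p)]} /\
  forall h k, local_martingale P
    (fun w t => dot h (M w t) * dot k (M w t) - dot h (Q w t k)).

Definition operator_bracket P : Om -> I -> op :=
  get [set Q : Om -> I -> op | is_operator_bracket P (martingale_part P) Q].

(* The Ito integrals int_s^t X_{s,r} (x) dX_r, as the limit in probability of
   the left-point sums, in a version which is continuous in (s, t). *)
Definition is_ito_integral P (J : Om -> simplex -> op) :=
  {ae P, forall w, (forall p, hs_op (J w p)) /\ field_continuous hs_norm (J w)} /\
  forall (p : simplex) (e : R), 0 < e -> exists2 delta : R, 0 < delta &
    forall n pi, subdivision (lo p) (hi p) n pi -> mesh_le n pi delta ->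
    exists B : set Om, [/\ measurable B, (P B <= e%:E)%E &
      forall w, ~ B w ->
        (hs_norm (riemann_sum (coord w) (lo p) n pi - J w p)%R <= e%:E)%E].

Definition ito_integral P : Om -> simplex -> op :=
  get [set J : Om -> simplex -> op | is_ito_integral P J].

Definition area P (w : Om) (p : simplex) : op := anti (ito_integral P w p).

Definition quasi_surely (PP : set (law H T)) (A : set Om) :=
  forall P, PP P -> {ae P, forall w, A w}.

Definition causal_state (PP : set (law H T)) (S : causal_space T)
    (sigma : Om -> S) :=
  [/\ causal_polish S,
      forall B : set S, <<s (@open S) >> B -> measurable (sigma @^-1` B) &
      exists N : set Om, [/\ measurable N, forall P, PP P -> P N = 1%E &
        forall w w', N w -> N w' -> forall t,
          stop t (coord w) = stop t (coord w') ->
          trunc t (sigma w) = trunc t (sigma w')]].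

(* [precedes PP tau sigma] is tau <= sigma *)
Definition precedes (PP : set (law H T)) (S' S : causal_space T)
    (tau : Om -> S') (sigma : Om -> S) :=
  exists2 f : S -> S', stable_causal f &
    quasi_surely PP [set w | tau w = f (sigma w)].

Definition stable_causal_equiv (PP : set (law H T)) (S S' : causal_space T)
    (sigma : Om -> S) (sigma' : Om -> S') :=
  precedes PP sigma sigma' /\ precedes PP sigma' sigma.

Definition canonical_lift P (w : Om) : lift_type H T :=
  (coord w, area P w, operator_bracket P w).

Definition common_accessibility (eta : R) (PP : set (law H T))
    (A2 : Om -> Zeta H T eta) :=
  causal_state PP A2 /\
  forall P, PP P -> {ae P, forall w, ch (zeta_val (A2 w)) = canonical_lift P w}.

Definition joint_realization (eta : R) (PP : set (law H T))
    (S : causal_space T) (sigma : Om -> S) (Psi : S -> Rcoh H T eta) :=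
  stable_causal Psi /\
  forall P, PP P ->
    {ae P, forall w, coh_val (Psi (sigma w)) = encode (canonical_lift P w)}.

Definition jointly_realizes (eta : R) (PP : set (law H T))
    (S : causal_space T) (sigma : Om -> S) :=
  exists Psi : S -> Rcoh H T eta, joint_realization PP sigma Psi.

Definition jointly_sufficient (eta : R) (PP : set (law H T))
    (S : causal_space T) (sigma : Om -> S) :=
  causal_state PP sigma /\ jointly_realizes eta PP sigma.

Definition least_sufficient (eta : R) (PP : set (law H T))
    (S : causal_space T) (sigma : Om -> S) :=
  jointly_sufficient eta PP sigma /\
  forall (S' : causal_space T) (sigma' : Om -> S'),
    jointly_sufficient eta PP sigma' -> precedes PP sigma sigma'.

Definition is_factor (eta : R) (PP : set (law H T))
    (A2 : Om -> Zeta H T eta) (S : causal_space T) (sigma : Om -> S)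
    (f : S -> Zeta H T eta) :=
  stable_causal f /\ quasi_surely PP [set w | f (sigma w) = A2 w].

Definition agree_on_source (PP : set (law H T)) (S : causal_space T)
    (sigma : Om -> S) (V : Type) (f g : S -> V) :=
  quasi_surely PP [set w | f (sigma w) = g (sigma w)].

End semimartingales.

(* Main.v *)
Require Import Defs.
From mathcomp Require Import all_boot all_order all_algebra.
From mathcomp Require Import all_classical all_reals all_analysis.

(** The target profile of the response specification is, almost surely under
    each law, the encoding of the canonical lift, and common accessibility says
    that this lift is read off from the single state [A2].  Hence, by
    [target_response], the required response is [O (A2 w)] under every law.
    A map [Psi] out of a source is thus a joint realization exactly when it is
    stable-causal and [Psi (sigma w) = O (A2 w)] quasi surely
    ([joint_realizationP]), a condition that sees the laws only through their
    null sets.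

    What remains is formal: [O] and [D] are mutually inverse and both
    stable-causal, and stable-causal maps compose.  Composing with [D] turns a
    realization into a factor of [A2] through the source, and composing with
    [O] turns a factor into a realization.  In particular [O]
    realizes the specification from [A2] itself, so that [A2] is sufficient,
    and it precedes every sufficient state; two least states precede each
    other. *)

Local Open Scope classical_set_scope.
Local Open Scope ring_scope.

(** Stopping the input of the inner map may be done before or after it, because
    the outer map, observed up to time [t], only sees its input up to [t]. *)
Lemma stable_causal_comp (R : realType) (T : R) (S1 S2 S3 : causal_space T)
    (f : S1 -> S2) (g : S2 -> S3) :
  stable_causal f -> stable_causal g -> stable_causal (g \o f).
Proof.
move=> [cf sf] [cg sg]; split.
  by move=> x; apply: continuous_comp; [exact: cf | exact: cg].
by move=> t x /=; rewrite sg sf -sg.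
Qed.

Lemma coh_val_inj (R : realType) (H : hilbertType R) (T eta : R) :
  injective (@coh_val R H T eta).
Proof. by move=> r r'; exact: val_inj. Qed.

Section quasi_sure.
Context {R : realType} {H : hilbertType R} {T : R}.
Implicit Types (PP : set (law H T)) (A B : set (OmegaB H T)).

Lemma sub_quasi_surely PP A B :
  A `<=` B -> quasi_surely PP A -> quasi_surely PP B.
Proof. by move=> AB qA P /qA; apply: filterS. Qed.

Lemma quasi_surelyT PP A : (forall w, A w) -> quasi_surely PP A.
Proof. by move=> AT P _; apply: aeW. Qed.

End quasi_sure.

Section accessible_state.
Context {R : realType} {H : hilbertType R} {T eta : R}.
Context {PP : set (law H T)} {A2 : OmegaB H T -> Zeta H T eta}.
Context {O : Zeta H T eta -> Rcoh H T eta} {D : Rcoh H T eta -> Zeta H T eta}.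
Hypotheses (hA2 : common_accessibility PP A2) (hOD : encoder_decoder O D).

(** The law enters the target only through the canonical lift, for which [A2]
    provides one version valid under all laws. *)
Lemma target_response P : PP P ->
  {ae P, forall w, encode (canonical_lift P w) = coh_val (O (A2 w))}.
Proof.
have [OE _ _ _ _] := hOD; have [_ chA2] := hA2.
by move=> /chA2; apply: filterS => w chw; rewrite OE chw.
Qed.

(** Profiles determine coherent responses, so the almost sure identities of
    profiles under the individual laws amount to one quasi-sure identity in
    the coherent response space. *)
Lemma joint_realizationP (S : causal_space T) (sigma : OmegaB H T -> S)
    (Psi : S -> Rcoh H T eta) :
  joint_realization PP sigma Psi <->
  stable_causal Psi /\
    quasi_surely PP [set w | Psi (sigma w) = O (A2 w)].
Proof.
split=> -[cPsi PsiE]; split=> // P PPP; have := PsiE P PPP;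
  have := target_response P PPP; apply: filterS2 => w /=.
- by move=> -> /coh_val_inj.
- by move=> -> ->.
Qed.

Lemma is_factor_decode {S : causal_space T} {sigma : OmegaB H T -> S}
    {Psi : S -> Rcoh H T eta} :
  joint_realization PP sigma Psi -> is_factor PP A2 sigma (D \o Psi).
Proof.
have [_ _ [OK _] _ cD] := hOD.
move=> /joint_realizationP[cPsi PsiE]; split; first exact: stable_causal_comp.
by apply: sub_quasi_surely PsiE => w /= ->; rewrite OK.
Qed.

Lemma joint_realization_encode {S : causal_space T} {sigma : OmegaB H T -> S}
    {f : S -> Zeta H T eta} :
  is_factor PP A2 sigma f -> joint_realization PP sigma (O \o f).
Proof.
have [_ _ _ cO _] := hOD.
move=> [cf fE]; apply/joint_realizationP; split; first exact: stable_causal_comp.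
by apply: sub_quasi_surely fE => w /= ->.
Qed.

Lemma precedes_factor (S : causal_space T) (sigma : OmegaB H T -> S) :
  precedes PP A2 sigma <-> exists f, is_factor PP A2 sigma f.
Proof.
split=> [[f cf fE]|[f [cf fE]]]; exists f => //; last first.
  by apply: sub_quasi_surely fE => w /= ->.
by split=> //; apply: sub_quasi_surely fE => w /= ->.
Qed.

Lemma jointly_realizes_precedes (S : causal_space T)
    (sigma : OmegaB H T -> S) :
  jointly_realizes eta PP sigma <-> precedes PP A2 sigma.
Proof.
rewrite precedes_factor; split=> [[Psi /is_factor_decode]|[f]].
  by exists (D \o Psi).
by move=> /joint_realization_encode; exists (O \o f).
Qed.

(** Sufficiency of [A2] is witnessed by the encoder itself; leastness is the
    factorization through an arbitrary sufficient state. *)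
Lemma least_sufficient_accessible : least_sufficient eta PP A2.
Proof.
have [_ _ _ cO _] := hOD; have [csA2 _] := hA2; split.
  split=> //; exists O; apply/joint_realizationP; split=> //.
  exact: quasi_surelyT.
by move=> S sigma [_ /jointly_realizes_precedes].
Qed.

End accessible_state.

Lemma least_sufficient_equiv (R : realType) (H : hilbertType R) (T eta : R)
    (PP : set (law H T)) (S S' : causal_space T)
    (sigma : OmegaB H T -> S) (sigma' : OmegaB H T -> S') :
  least_sufficient eta PP sigma -> least_sufficient eta PP sigma' ->
  stable_causal_equiv PP sigma sigma'.
Proof.
move=> [suff least] [suff' least'].
by split; [exact: least | exact: least'].
Qed.

Theorem theorem3p2 (R : realType) (H : hilbertType R) (T eta : R)
    (PP : set (law H T)) (A2 : OmegaB H T -> Zeta H T eta)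
    (O : Zeta H T eta -> Rcoh H T eta) (D : Rcoh H T eta -> Zeta H T eta)
    (hH : separable H) (hT : 0 < T) (heta : 3^-1 < eta < 2^-1)
    (hPP : PP !=set0) (hsemi : forall P, PP P -> semimartingale_law P)
    (hA2 : common_accessibility PP A2) (hOD : encoder_decoder O D) :
  (forall (S : causal_space T) (sigma : OmegaB H T -> S),
    causal_state PP sigma ->
    [/\ jointly_realizes eta PP sigma <-> precedes PP A2 sigma,
        forall Psi, joint_realization PP sigma Psi ->
          is_factor PP A2 sigma (D \o Psi),
        forall f, is_factor PP A2 sigma f ->
          joint_realization PP sigma (O \o f),
        (forall Psi Psi', joint_realization PP sigma Psi ->
           joint_realization PP sigma Psi' ->
           agree_on_source PP sigma Psi Psi' ->
           agree_on_source PP sigma (D \o Psi) (D \o Psi')) /\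
        (forall f f', is_factor PP A2 sigma f -> is_factor PP A2 sigma f' ->
           agree_on_source PP sigma f f' ->
           agree_on_source PP sigma (O \o f) (O \o f')) &
        (forall Psi, joint_realization PP sigma Psi ->
           agree_on_source PP sigma (O \o (D \o Psi)) Psi) /\
        (forall f, is_factor PP A2 sigma f ->
           agree_on_source PP sigma (D \o (O \o f)) f)]) /\
  least_sufficient eta PP A2 /\
  (forall (S : causal_space T) (sigma : OmegaB H T -> S),
    least_sufficient eta PP sigma -> stable_causal_equiv PP sigma A2).
Proof.
have [_ _ [OK DK] _ _] := hOD.
split; last first.
  have leastA2 := least_sufficient_accessible hA2 hOD.
  by split=> // S sigma /least_sufficient_equiv; apply.
move=> S sigma _; split.
- exact: (jointly_realizes_precedes hA2 hOD).
- by move=> Psi; exact: (is_factor_decode hA2 hOD).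
- by move=> f; exact: (joint_realization_encode hA2 hOD).
- by split=> [Psi Psi'|f f'] _ _; apply: sub_quasi_surely => w /= ->.
- by split=> [Psi|f] _; apply: quasi_surelyT => w /=; rewrite ?DK ?OK.
Qed.
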